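(* For every integer $q\geq 2$, on every instance of $\mathsf{2\,CSP\!-\!q}$ with strong chromatic number $\nu\geq 2$, the average differential ratio is bounded below by $$\frac{1}{q\lceil(\nu-1)/q\rceil(q-1)+q},$$ a quantity that is asymptotically equivalent to $\frac{1}{(q-1)\nu}$ (as $\nu\to\infty$).
   Context: Let $\Sigma_q=\{0,1,\ldots,q-1\}$ and $[n]=\{1,\ldots,n\}$. An instance $I$ of $\mathsf{k\,CSP\!-\!q}$ (here $k=2$) consists of integers $n,m\ge 1$, a goal (maximize or minimize) and, for each $i\in[m]$, a weight $w_i>0$, an integer $1\le k_i\leq \min\{k,n\}$, a strictly increasing sequence $J_i=(i_1,\ldots,i_{k_i})$ of indices of $[n]$, and a function $P_i:\Sigma_q^{k_i}\to\mathbb{R}$. Solutions are vectors $x\in\Sigma_q^n$, with value $v(I,x)=\sum_{i=1}^m w_iP_i(x_{i_1},\ldots,x_{i_{k_i}})$. $\mathrm{opt}(I)$ and $\mathrm{wor}(I)$ are the best and worst solution values (maximum and minimum of $v(I,\cdot)$ if maximizing, minimum and maximum if minimizing). The average differential ratio on $I$ is $(\mathbb{E}_X[v(I,X)]-\mathrm{wor}(I))/(\mathrm{opt}(I)-\mathrm{wor}(I))$ with $X$ uniform on $\Sigma_q^n$ (considered when $\mathrm{opt}(I)\neq\mathrm{wor}(I)$). The strong chromatic number of $I$ is the smallest $\nu$ such that there is a partition of $[n]$ into $\nu$ sets such that each $J_i$ contains at most one index from each set. *)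

(* Defs.v *)
From mathcomp Require Import all_boot all_order all_algebra archimedean.
From mathcomp Require Import boolp classical_sets reals topology normedtype landau.

Set Implicit Arguments.
Unset Strict Implicit.
Unset Printing Implicit Defensive.

Import Order.TTheory GRing.Theory Num.Theory.
Import numFieldTopology.Exports numFieldNormedType.Exports.

Local Open Scope ring_scope.

(* The index set [n] is 'I_n and the alphabet Sigma_q is 'I_q. *)

Inductive goal := Maximize | Minimize.

Record csp_constraint (R : realType) (k q n : nat) := CspConstraint {
  weight : R ;
  weight_gt0 : 0 < weight ;
  arity : nat ;
  arity_gt0 : (1 <= arity)%N ;
  arity_le : (arity <= minn k n)%N ;
  scope : arity.-tuple 'I_n ;
  scope_increasing : sorted ltn [seq val j | j <- scope] ;
  payoff : arity.-tuple 'I_q -> R }.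

Record csp_instance (R : realType) (k q : nat) := CspInstance {
  nvars : nat ;
  nvars_gt0 : (1 <= nvars)%N ;
  ncons : nat ;
  ncons_gt0 : (1 <= ncons)%N ;
  objective : goal ;
  constr : 'I_ncons -> csp_constraint R k q nvars }.

Arguments constr {R k q} _ _.

Definition solution (R : realType) (k q : nat) (I : csp_instance R k q) :=
  {ffun 'I_(nvars I) -> 'I_q}.

Definition value (R : realType) (k q : nat) (I : csp_instance R k q)
    (x : solution I) : R :=
  \sum_(i < ncons I)
    weight (constr I i) * payoff (map_tuple x (scope (constr I i))).

(* The sup and inf below range over a finite set, nonempty as soon as 0 < q:
   they are then a maximum and a minimum (max_valueP, min_valueP). *)
Definition max_value (R : realType) (k q : nat) (I : csp_instance R k q) : R :=
  sup (range (@value R k q I)).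

Definition min_value (R : realType) (k q : nat) (I : csp_instance R k q) : R :=
  inf (range (@value R k q I)).

Lemma max_valueP (R : realType) (k q : nat) (I : csp_instance R k q) :
  (0 < q)%N ->
  (exists x : solution I, value x = max_value I) /\
  (forall x : solution I, value x <= max_value I).
Proof.
move=> q_gt0; pose x0 : solution I := [ffun=> Ordinal q_gt0].
case: (@Order.TotalTheory.arg_maxP _ R _ x0 predT (@value R k q I) isT) => x _ ub.
suff -> : max_value I = value x by split=> [|y]; [exists x | exact: ub].
have ubE : ubound (range (@value R k q I)) (value x).
  by move=> _ [y _ <-]; exact: ub.
apply/le_anti/andP; split; first by apply: ge_sup => //; exists (value x), x.
by apply: ub_le_sup; [exists (value x) | exists x].
Qed.

Lemma min_valueP (R : realType) (k q : nat) (I : csp_instance R k q) :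
  (0 < q)%N ->
  (exists x : solution I, value x = min_value I) /\
  (forall x : solution I, min_value I <= value x).
Proof.
move=> q_gt0; pose x0 : solution I := [ffun=> Ordinal q_gt0].
case: (@Order.TotalTheory.arg_minP _ R _ x0 predT (@value R k q I) isT) => x _ lb.
suff -> : min_value I = value x by split=> [|y]; [exists x | exact: lb].
have lbE : lbound (range (@value R k q I)) (value x).
  by move=> _ [y _ <-]; exact: lb.
apply/le_anti/andP; split; last by apply: lb_le_inf => //; exists (value x), x.
by apply: ge_inf; [exists (value x) | exists x].
Qed.

Definition opt (R : realType) (k q : nat) (I : csp_instance R k q) : R :=
  match objective I with
  | Maximize => max_value I
  | Minimize => min_value I
  end.

Definition wor (R : realType) (k q : nat) (I : csp_instance R k q) : R :=
  match objective I with
  | Maximize => min_value I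
  | Minimize => max_value I
  end.

Definition mean_value (R : realType) (k q : nat) (I : csp_instance R k q) : R :=
  (\sum_(x : solution I) value x) / #|{: solution I}|%:R.

Definition average_differential_ratio (R : realType) (k q : nat)
    (I : csp_instance R k q) : R :=
  (mean_value I - wor I) / (opt I - wor I).

Definition strong_coloring (R : realType) (k q : nat) (I : csp_instance R k q)
    (P : {set {set 'I_(nvars I)}}) : bool :=
  finset.partition P [set: 'I_(nvars I)]%SET &&
  [forall i : 'I_(ncons I), forall S in P,
     (#|[pred j in S | j \in scope (constr I i)]| <= 1)%N].

Definition strongly_colorable (R : realType) (k q : nat)
    (I : csp_instance R k q) (nu : nat) : bool :=
  [exists P : {set {set 'I_(nvars I)}}, strong_coloring P && (#|P| == nu)].

Lemma strongly_colorable_ex (R : realType) (k q : nat)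
    (I : csp_instance R k q) : exists nu, strongly_colorable I nu.
Proof.
pose P := preim_partition (@id 'I_(nvars I)) [set: 'I_(nvars I)]%SET.
exists #|P|; apply/existsP; exists P; rewrite eqxx andbT.
apply/andP; split; first exact: preim_partitionP.
apply/forallP=> i; apply/forall_inP=> S /imsetP[a _ ->].
rewrite -(card1 a); apply/subset_leq_card/fintype.subsetP=> b.
by rewrite !inE => /andP[/eqP-> _]; rewrite eqxx.
Qed.

Definition strong_chromatic_number (R : realType) (k q : nat)
    (I : csp_instance R k q) : nat :=
  ex_minn (strongly_colorable_ex I).

Definition ratio_bound (R : realType) (q nu : nat) : R :=
  1 / (q%:R * (Num.ceil ((nu%:R - 1) / q%:R : R))%:~R * (q%:R - 1) + q%:R).

Definition ratio_bound_equivalent (R : realType) (q nu : nat) : R :=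
  1 / ((q%:R - 1) * nu%:R).

(* Main.v *)
Require Import Defs.
From mathcomp Require Import all_boot all_order all_algebra archimedean.
From mathcomp Require Import boolp classical_sets functions reals topology normedtype landau.
From mathcomp Require Import ring zify.

Import Order.TTheory GRing.Theory Num.Theory.
Import numFieldTopology.Exports numFieldNormedType.Exports.

Local Open Scope classical_set_scope.
Local Open Scope ring_scope.

(** Fix a solution [x] and a strong colouring of the variables with at most
    [N = q * c + 1] colours.  The mean value of the instance is the expected
    value of ANY random solution in which variables of different colours are
    pairwise independent and uniform on the alphabet, because each constraint
    reads at most two variables, of different colours.  So it suffices to
    build such a random solution that equals [x] with probability at least
    [p = 1 / (q * w)], where [w = c * (q - 1) + 1]: the mean value is then a
    convex combination of solution values with weight at least [p] on
    [value x].  Taking [x] optimal and bounding the other values by the worst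
    one shows that the average differential ratio is at least [p], and [p]
    is the announced bound for [c = ceil ((nu - 1) / q)].

    The random solution first draws a set [T] of colours, empty with
    probability [p] and otherwise uniform among the sets of exactly [w] of the
    [N] colours.  Each variable whose colour is in [T] is then redrawn
    uniformly among the [q - 1] symbols other than its value in [x]; the
    variables whose colour is outside [T] are left alone.  For a uniform
    pairwise independent outcome, a given colour must avoid [T] with
    probability [1 / q] and two given colours must both avoid [T] with
    probability [1 / q ^ 2].  The first two moments of [#|T|] decide this, and
    with [#|T|] in [{0, w}] they are matched exactly when the number of
    colours is [1] modulo [q] ([resampling_law_disjoint]).  Colours that no
    variable uses are harmless, so rounding [nu] up to such a number is what
    produces the ceiling.  Pairwise uniformity is [rebalanced_pairwise]; the
    identity for the mean value is [mean_value_rebalanced].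

    For the asymptotic equivalence, the two denominators differ by a bounded
    amount since the ceiling exceeds its argument by less than one. *)

(** * Product distributions on finite functions *)

Definition product_weight {R : realType} {V A : finType} (m : V -> A -> R)
    (y : {ffun V -> A}) : R := \prod_v m v (y v).

Lemma sum_product_weight {R : realType} {V A : finType} (m : V -> A -> R) :
  (forall v, \sum_a m v a = 1) -> \sum_y product_weight m y = 1.
Proof. by move=> m1; rewrite /product_weight -bigA_distr_bigA big1. Qed.

(** Under a product distribution, reading distinct coordinates yields
    independent symbols: grouping the functions by what they show on [J], each
    group is a box, whose weight factors; the coordinates outside [J] are free
    and contribute a factor one. *)
Lemma product_weight_marginal {R : realType} {V A : finType} (m : V -> A -> R)
    (d : nat) (J : d.-tuple V) (h : d.-tuple A -> R) :
  (forall v, \sum_a m v a = 1) -> uniq J ->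
  \sum_y product_weight m y * h (map_tuple y J) =
  \sum_t h t * \prod_(i < d) m (tnth J i) (tnth t i).
Proof.
move=> m1 uJ; rewrite (partition_big (fun y : {ffun V -> A} => map_tuple y J) predT) //=.
apply: eq_bigr => t _.
(* [family Q] is the box of the functions showing [t] on [J]. *)
pose Q v a := [forall i, (tnth J i == v) ==> (a == tnth t i)].
have restrE (y : {ffun V -> A}) : (map_tuple y J == t) = (y \in family Q).
  apply/eqP/familyP => [yt v | yQ].
    by apply/forallP => i; apply/implyP => /eqP <-; rewrite -yt tnth_map.
  apply: eq_from_tnth => i; rewrite tnth_map; apply/eqP.
  by have /forallP/(_ i)/implyP := yQ (tnth J i); apply.
have -> : \prod_(i < d) m (tnth J i) (tnth t i) = \prod_v \sum_(a | Q v a) m v a.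
  rewrite [RHS](bigID (mem J)) /= [X in _ = _ * X]big1 ?mulr1.
    rewrite -big_uniq // big_tuple; apply: eq_bigr => i _.
    rewrite (big_pred1 (tnth t i)) // => a.
    apply/forallP/idP => [/(_ i)|/eqP -> k]; first by rewrite eqxx.
    by apply/implyP => /eqP/(tuple_uniqP _ uJ) ->.
  move=> v vJ; rewrite -(m1 v); apply: eq_bigl => a.
  apply/forallP => i; apply/implyP => /eqP Jiv.
  by rewrite -Jiv mem_tnth in vJ.
rewrite bigA_distr_big_dep mulr_sumr; apply: eq_big => [y|y /eqP <-].
  by rewrite restrE.
by rewrite mulrC.
Qed.

(** * The random set of resampled colours *)

(** The probability of drawing [T].  As [w] is positive, the two terms never
    apply to the same [T]. *)
Definition resampling_law (R : realType) (q c : nat) (T : {set 'I_(q * c).+1}) : R :=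
  let w := (c * (q - 1)).+1 in
  let p := (q * w)%:R^-1 in
  p *+ (T == finset.set0)
  + (1 - p) / ('C((q * c).+1, w))%:R *+ (#|T| == w).

Lemma resampling_law_ge0 (R : realType) (q c : nat) (T : {set 'I_(q * c).+1}) :
  (2 <= q)%N -> 0 <= resampling_law R q c T.
Proof.
move=> hq; rewrite addr_ge0 // mulrn_wge0 ?invr_ge0 // divr_ge0 // subr_ge0.
by rewrite invf_le1 ?ler1n ?ltr0n; lia.
Qed.

Lemma resampling_law0 (R : realType) (q c : nat) :
  resampling_law R q c finset.set0 = (q * (c * (q - 1)).+1)%:R^-1.
Proof. by rewrite /resampling_law eqxx finset.cards0 mulr0n addr0. Qed.

(** The colours of [S] all avoid [T] with the same probability as [#|S|]
    independent events of probability [1 / q].  This can hold for at most two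
    colours only: with [k = #|S|], the left side is
    [p + (1 - p) * 'C(N - k, w) / 'C(N, w)], and since [N - w = c] the ratio of
    binomials is [1], [c / N] and [c * (c - 1) / (N * (N - 1))] for
    [k = 0, 1, 2].  The values of [w] and [p] are the solution of the two
    equations obtained for [k = 1] and [k = 2]. *)
Lemma resampling_law_disjoint (R : realType) (q c : nat) (S : {set 'I_(q * c).+1}) :
  (2 <= q)%N -> (1 <= c)%N -> (#|S| <= 2)%N ->
  \sum_(T : {set 'I_(q * c).+1} | T \subset ~: S) resampling_law R q c T
    = q%:R ^- #|S|.
Proof.
move=> hq hc hS.
rewrite /resampling_law; set w := (c * (q - 1)).+1; set p := (_)%:R^-1.
rewrite big_split /= (bigD1 finset.set0) ?finset.sub0set //= eqxx mulr1n.
rewrite [X in _ + X + _]big1 => [|T /andP[_ /negbTE ->]]; last by rewrite mulr0n.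
rewrite addr0; under eq_bigr do rewrite mulrb.
rewrite -big_mkcondr /=.
rewrite sumr_const.
rewrite -(_ : #|[set A : {set 'I_(q * c).+1} | A \subset ~: S & #|A| == w]%SET| = #|_|);
  last by apply: eq_card => T; rewrite !inE.
rewrite cards_draws.
have -> : #|~: S| = ((q * c).+1 - #|S|)%N.
  by rewrite finset.cardsCs finset.setCK card_ord.
have C0 : ('C((q * c).+1, w))%:R != 0 :> R by rewrite pnatr_eq0 -lt0n bin_gt0; nia.
have q0 : q%:R != 0 :> R by rewrite pnatr_eq0; lia.
have wE : w%:R = c%:R * (q%:R - 1) + 1 :> R.
  by rewrite /w -natr1 natrM natrB //; lia.
have w0 : w%:R != 0 :> R by rewrite pnatr_eq0.
have pE : p = (q%:R * (c%:R * (q%:R - 1) + 1))^-1 by rewrite /p natrM wE.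
have w0' := w0; rewrite wE in w0'.
have N0 : (q * c).+1%:R = q%:R * c%:R + 1 :> R by rewrite -natr1 natrM.
have N0' : q%:R * c%:R + 1 != 0 :> R by rewrite -N0 pnatr_eq0.
have c0 : c%:R != 0 :> R by rewrite pnatr_eq0; lia.
have C1 : ('C(q * c, w))%:R = c%:R / (q%:R * c%:R + 1) * ('C((q * c).+1, w))%:R :> R.
  have /(congr1 (fun k => k%:R : R)) := mul_bin_down (q * c).+1 w.
  rewrite /= !natrM (_ : (q * c).+1 - w = c)%N; last by rewrite /w; nia.
  rewrite N0 => /(canRL (mulKf N0')) ->; by field.
have C2 : ('C((q * c).-1, w))%:R = (c%:R - 1) / (q%:R * c%:R) * ('C(q * c, w))%:R :> R.
  have /(congr1 (fun k => k%:R : R)) := mul_bin_down (q * c) w.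
  rewrite /= !natrM (_ : q * c - w = c - 1)%N; last by rewrite /w; nia.
  rewrite natrB // => /(canRL (mulKf (mulf_neq0 q0 c0))) ->; by field; rewrite q0 c0.
case: #|S| hS => [|[|[|//]]] _ /=.
- by rewrite subn0 -[X in _ + X]mulr_natr expr0 invr1 divfK //; ring.
- rewrite subn1 succnK -[X in _ + X]mulr_natr C1 pE expr1 /=; field.
  by rewrite q0 w0' N0' C0.
- rewrite (_ : (q * c).+1 - 2 = (q * c).-1)%N; last by nia.
  rewrite -[X in _ + X]mulr_natr C2 C1 pE expr2; field.
  by rewrite q0 w0' N0' C0 c0.
Qed.

(** * Resampling a solution *)

(** The distribution of the symbol of [v], once the set [T] is drawn. *)
Definition resampled {R : realType} {V C : finType} {q : nat}
    (x : {ffun V -> 'I_q}) (kappa : V -> C) (T : {set C}) (v : V) (s : 'I_q) : R :=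
  if kappa v \in T then (s != x v)%:R / (q%:R - 1) else (s == x v)%:R.

Lemma sum_resampled {R : realType} {V C : finType} {q : nat}
    (x : {ffun V -> 'I_q}) (kappa : V -> C) (T : {set C}) (v : V) :
  (2 <= q)%N -> \sum_s resampled x kappa T v s = 1 :> R.
Proof.
move=> hq; have delta1 : \sum_s (s == x v)%:R = 1 :> R.
  by rewrite (bigD1 (x v)) //= eqxx big1 ?addr0 // => s /negbTE ->.
rewrite /resampled; case: (kappa v \in T) => //.
rewrite -mulr_suml (eq_bigr (fun s => 1 - (s == x v)%:R)) => [|s _]; last first.
  by case: eqP => _; rewrite ?subrr ?subr0.
rewrite sumrB delta1 sumr_const card_ord divff //.
by rewrite subr_eq0 pnatr_eq1; lia.
Qed.

Definition rebalanced_law {R : realType} {V : finType} {q c : nat}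
    (x : {ffun V -> 'I_q}) (kappa : V -> 'I_(q * c).+1) (y : {ffun V -> 'I_q}) : R :=
  \sum_(T : {set 'I_(q * c).+1})
    resampling_law R q c T * product_weight (resampled x kappa T) y.

(** On at most two variables of distinct colours, the random solution is
    uniform.  Given [T], the probability of a symbol is affine in the indicator
    that its colour avoids [T], say [b * e + u]; replacing [b] by its mean
    [1 / q] turns this into [1 / q].  The product over the variables is
    multilinear in the indicators, so only the probabilities that given colours
    all avoid [T] matter, and these are those of independent events. *)
Lemma rebalanced_pairwise {R : realType} {V : finType} {q c d : nat}
    (x : {ffun V -> 'I_q}) (kappa : V -> 'I_(q * c).+1)
    (J : d.-tuple V) (t : d.-tuple 'I_q) :
  (2 <= q)%N -> (1 <= c)%N -> (d <= 2)%N -> uniq (map kappa J) ->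
  \sum_(T : {set 'I_(q * c).+1}) resampling_law R q c T *
     \prod_(i < d) resampled x kappa T (tnth J i) (tnth t i)
  = \prod_(i < d) q%:R^-1.
Proof.
move=> hq hc hd uJ.
(* [u] and [u + e] are the probabilities of the symbol [t_i] in the two
   cases: colour of [J_i] in [T], and outside [T]. *)
pose u i : R := (tnth t i != x (tnth J i))%:R / (q%:R - 1).
pose e i : R := (tnth t i == x (tnth J i))%:R - u i.
have q0 : q%:R != 0 :> R by rewrite pnatr_eq0; lia.
have q1 : q%:R - 1 != 0 :> R by rewrite subr_eq0 pnatr_eq1; lia.
have uniformE i : q%:R^-1 = q%:R^-1 * e i + u i.
  by rewrite /e /u; case: eqP => _ /=; field; rewrite ?q0 ?q1.
have resampledE T i : resampled x kappa T (tnth J i) (tnth t i)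
    = (kappa (tnth J i) \notin T)%:R * e i + u i.
  by rewrite /resampled /e /u; case: ifP => _ /=; ring.
under [RHS]eq_bigr => i _ do rewrite (uniformE i).
rewrite [RHS]bigA_distr.
transitivity (\sum_(T : {set 'I_(q * c).+1}) \sum_(S : {set 'I_d}) resampling_law R q c T *
    \prod_(i < d) (if i \in S then (kappa (tnth J i) \notin T)%:R * e i else u i)).
  apply: eq_bigr => T _; rewrite -mulr_sumr -bigA_distr.
  by congr (_ * _); apply: eq_bigr => i _; exact: resampledE.
rewrite exchange_big; apply: eq_bigr => S _ /=.
pose K := [set kappa (tnth J i) | i in S]%SET.
have cardK : #|K| = #|S|.
  apply: card_in_imset => i j _ _ /= eqk.
  have /tuple_uniqP : uniq (map_tuple kappa J) by [].
  by apply; rewrite !tnth_map.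
pose r := \prod_(i < d) (if i \in S then e i else u i).
have splitT (b : R) : \prod_(i < d) (if i \in S then b * e i else u i) = b ^+ #|S| * r.
  rewrite -prodr_const [X in _ = X * _]big_mkcond -big_split; apply: eq_bigr => i _ /=.
  by case: ifP; rewrite ?mul1r.
rewrite splitT exprVn -cardK.
rewrite -(resampling_law_disjoint R q c K hq hc); last first.
  by rewrite cardK (leq_trans (max_card _)) // card_ord.
rewrite mulr_suml [RHS]big_mkcond; apply: eq_bigr => T _.
have -> : \prod_(i < d) (if i \in S then (kappa (tnth J i) \notin T)%:R * e i else u i)
    = (T \subset ~: K)%:R * r.
  rewrite -finset.disjoints_subset; case: (boolP [disjoint T & K]) => [TK|].
    rewrite mul1r; apply: eq_bigr => i _; case: ifP => // iS.
    by rewrite (disjointFl TK) ?mul1r //; apply/imsetP; exists i.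
  rewrite -finset.setI_eq0 => /set0Pn[k /setIP[kT /imsetP[i iS kE]]].
  by rewrite mul0r (bigD1 i) //= iS -kE kT /= !mul0r.
by case: ifP => _; rewrite ?mul1r ?mul0r ?mulr0.
Qed.

Lemma product_weight_resampled_ge0 {R : realType} {V C : finType} {q : nat}
    (x : {ffun V -> 'I_q}) (kappa : V -> C) (T : {set C}) (y : {ffun V -> 'I_q}) :
  (2 <= q)%N -> 0 <= product_weight (resampled x kappa T) y :> R.
Proof.
move=> hq; apply: prodr_ge0 => v _; rewrite /resampled; case: ifP => _ //.
by rewrite divr_ge0 // subr_ge0 ler1n; lia.
Qed.

Lemma rebalanced_law_ge0 {R : realType} {V : finType} {q c : nat}
    (x : {ffun V -> 'I_q}) (kappa : V -> 'I_(q * c).+1) (y : {ffun V -> 'I_q}) :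
  (2 <= q)%N -> 0 <= rebalanced_law x kappa y :> R.
Proof.
move=> hq; apply: sumr_ge0 => T _.
by rewrite mulr_ge0 ?resampling_law_ge0 ?product_weight_resampled_ge0.
Qed.

Lemma sum_rebalanced_law {R : realType} {V : finType} {q c : nat}
    (x : {ffun V -> 'I_q}) (kappa : V -> 'I_(q * c).+1) :
  (2 <= q)%N -> (1 <= c)%N -> \sum_y rebalanced_law x kappa y = 1 :> R.
Proof.
move=> hq hc; rewrite exchange_big /=.
under eq_bigr do rewrite -mulr_sumr.
rewrite -[RHS](_ : q%:R ^- #|finset.set0 : {set 'I_(q * c).+1}| = 1); last first.
  by rewrite finset.cards0 expr0 invr1.
rewrite -(@resampling_law_disjoint R) ?finset.cards0 //.
apply: eq_big => [T|T _]; first by rewrite finset.setC0 finset.subsetT.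
by rewrite sum_product_weight ?mulr1 // => v; exact: sum_resampled.
Qed.

(** Drawing the empty set of colours returns [x] itself. *)
Lemma rebalanced_law_base {R : realType} {V : finType} {q c : nat}
    (x : {ffun V -> 'I_q}) (kappa : V -> 'I_(q * c).+1) :
  (2 <= q)%N -> (q * (c * (q - 1)).+1)%:R^-1 <= rebalanced_law x kappa x :> R.
Proof.
move=> hq; rewrite /rebalanced_law (bigD1 finset.set0) //= resampling_law0.
rewrite {1}/product_weight big1 => [|v _]; last by rewrite /resampled finset.in_set0 eqxx.
rewrite mulr1 lerDl; apply: sumr_ge0 => T _.
by rewrite mulr_ge0 ?resampling_law_ge0 ?product_weight_resampled_ge0.
Qed.

(** * From colourings to the differential ratio *)

(** Numbering the blocks of the partition gives a colouring function; the
    slack [nu <= N.+1] leaves room for colours that no variable uses. *)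
Lemma strong_coloring_fun {R : realType} {k q : nat} (I : csp_instance R k q) (nu N : nat) :
  strongly_colorable I nu -> (nu <= N.+1)%N ->
  exists kappa : 'I_(nvars I) -> 'I_N.+1,
    forall i, uniq (map kappa (scope (constr I i))).
Proof.
move=> /existsP[P /andP[/andP[partP /forallP colP] /eqP cardP]] nuN.
have coverP j : j \in finset.cover P by rewrite (cover_partition partP) finset.in_setT.
exists (fun j => inord (index (finset.pblock P j) (enum P))) => i.
rewrite map_inj_in_uniq.
  apply: (@sorted_uniq _ (relpre val ltn)); last by rewrite -sorted_map scope_increasing.
  - by move=> a b d /=; exact: ltn_trans.
  - by move=> a; exact: ltnn.
have index_lt j : (index (finset.pblock P j) (enum P) < N.+1)%N.
  by rewrite (leq_trans _ nuN) // -cardP cardE index_mem mem_enum pblock_mem.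
move=> j l jJ lJ /(congr1 val) /=; rewrite !inordK // => /index_inj eqjl.
have {}eqjl : finset.pblock P j = finset.pblock P l.
  by apply: (eqjl finset.set0); rewrite mem_enum pblock_mem.
have /forall_inP/(_ _ (pblock_mem (coverP j)))/card_le1_eqP eqP1 := colP i.
by apply: eqP1; rewrite !inE ?jJ ?lJ ?andbT ?mem_pblock // eqjl mem_pblock.
Qed.

(** By linearity it is enough to compare expected payoffs one constraint at a
    time, and there the uniform and the rebalanced distributions agree. *)
Lemma mean_value_rebalanced {R : realType} {q c : nat} (I : csp_instance R 2 q)
    (x : solution I) (kappa : 'I_(nvars I) -> 'I_(q * c).+1) :
  (2 <= q)%N -> (1 <= c)%N ->
  (forall i, uniq (map kappa (scope (constr I i)))) ->
  mean_value I = \sum_y rebalanced_law x kappa y * value y.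
Proof.
move=> hq hc ukappa.
have q0 : q%:R != 0 :> R by rewrite pnatr_eq0; lia.
pose unif (v : 'I_(nvars I)) (s : 'I_q) : R := q%:R^-1.
have unif1 v : \sum_s unif v s = 1 by rewrite /unif sumr_const card_ord -[LHS]mulr_natr mulVf.
have -> : mean_value I = \sum_y product_weight unif y * value y.
  rewrite /mean_value mulrC mulr_sumr; apply: eq_bigr => y _; congr (_ * _).
  by rewrite /product_weight prodr_const card_ffun !card_ord natrX exprVn.
under eq_bigr do rewrite mulr_sumr.
under [RHS]eq_bigr do rewrite mulr_sumr.
rewrite exchange_big [RHS]exchange_big; apply: eq_bigr => i _ /=.
under eq_bigr do rewrite mulrCA.
under [RHS]eq_bigr do rewrite mulrCA.
rewrite -!mulr_sumr; congr (_ * _).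
have uJ := map_uniq (ukappa i).
have arity2 : (arity (constr I i) <= 2)%N.
  by rewrite (leq_trans (arity_le _)) // geq_minl.
rewrite product_weight_marginal //.
under [RHS]eq_bigr do rewrite mulr_suml.
rewrite exchange_big /=.
transitivity (\sum_(T : {set 'I_(q * c).+1}) \sum_t resampling_law R q c T *
    (payoff t * \prod_(j < arity (constr I i))
       resampled x kappa T (tnth (scope (constr I i)) j) (tnth t j))); last first.
  apply: eq_bigr => T _; under [RHS]eq_bigr do rewrite -mulrA.
  rewrite -!mulr_sumr product_weight_marginal // => v; exact: sum_resampled.
rewrite exchange_big; apply: eq_bigr => t _ /=.
under [RHS]eq_bigr do rewrite mulrCA.
by rewrite -mulr_sumr rebalanced_pairwise.
Qed.

(** The convexity argument for both goals at once: [g] is the deviation from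
    the worst value, [r - min] or [max - r], and commutes with expectation
    since it is affine. *)
Lemma mean_deviation {R : realType} {q c : nat} (I : csp_instance R 2 q)
    (g : R -> R) (x : solution I) (kappa : 'I_(nvars I) -> 'I_(q * c).+1) :
  (2 <= q)%N -> (1 <= c)%N ->
  (forall i, uniq (map kappa (scope (constr I i)))) ->
  (forall y : solution I, 0 <= g (value y)) ->
  (exists a b, forall r, g r = a * r + b) ->
  g (value x) / (q * (c * (q - 1)).+1)%:R <= g (mean_value I).
Proof.
move=> hq hc ukappa g_ge0 [a [b gE]].
have -> : g (mean_value I) = \sum_y rebalanced_law x kappa y * g (value y).
  under eq_bigr do rewrite gE mulrDr mulrCA.
  rewrite gE (@mean_value_rebalanced R q c I x kappa) // big_split /=.
  by rewrite -mulr_sumr -mulr_suml sum_rebalanced_law // mul1r.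
rewrite (bigD1 x) //= -[leLHS]addr0; apply: lerD.
  by rewrite mulrC ler_wpM2r // rebalanced_law_base.
by apply: sumr_ge0 => y _; rewrite mulr_ge0 ?rebalanced_law_ge0.
Qed.

Lemma average_differential_ratio_ge {R : realType} {q c : nat} (I : csp_instance R 2 q)
    (kappa : 'I_(nvars I) -> 'I_(q * c).+1) :
  (2 <= q)%N -> (1 <= c)%N ->
  (forall i, uniq (map kappa (scope (constr I i)))) ->
  opt I <> wor I ->
  (q * (c * (q - 1)).+1)%:R^-1 <= average_differential_ratio I.
Proof.
move=> hq hc ukappa; rewrite /average_differential_ratio /opt /wor.
have q_gt0 : (0 < q)%N by lia.
have [[xmax xmaxE] max_ub] := max_valueP I q_gt0.
have [[xmin xminE] min_lb] := min_valueP I q_gt0.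
have le_mM : min_value I <= max_value I by rewrite -xmaxE.
case: objective => /eqP neq.
  have gap : 0 < max_value I - min_value I by rewrite subr_gt0 lt_neqAle eq_sym neq.
  rewrite ler_pdivlMr // mulrC -xmaxE.
  apply: (@mean_deviation R q c I (fun r => r - min_value I) xmax kappa) => //.
    by move=> y; rewrite subr_ge0.
  by exists 1, (- min_value I) => r; rewrite mul1r.
have gap : 0 < max_value I - min_value I by rewrite subr_gt0 lt_neqAle neq.
rewrite -mulrNN -invrN !opprB ler_pdivlMr // mulrC -xminE.
apply: (@mean_deviation R q c I (fun r => max_value I - r) xmin kappa) => //.
  by move=> y; rewrite subr_ge0.
by exists (-1), (max_value I) => r; rewrite mulN1r addrC.
Qed.

(** * The bound and its asymptotics *)

(** The ceiling enters only through [nu - 1 <= q * c < nu - 1 + q]: the first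
    inequality provides enough colours, the second one controls the
    asymptotics. *)
Lemma ratio_boundE (R : realType) (q nu : nat) :
  (2 <= q)%N -> (2 <= nu)%N ->
  exists c : nat, [/\ (1 <= c)%N, (nu <= (q * c).+1)%N,
    (q * c < nu.-1 + q)%N & ratio_bound R q nu = (q * (c * (q - 1)).+1)%:R^-1].
Proof.
move=> hq hnu; rewrite /ratio_bound.
set r : R := (nu%:R - 1) / q%:R.
have q_gt0 : 0 < q%:R :> R by rewrite ltr0n; lia.
have nuE : nu%:R - 1 = nu.-1%:R :> R by rewrite -subn1 natrB //; lia.
have r_gt0 : 0 < r by rewrite divr_gt0 // nuE ltr0n; lia.
have c_gt0 : 0 < Num.ceil r by rewrite ceil_gt0.
have := ceil_itv r; case: (Num.ceil r) c_gt0 => // c c_gt0 /andP[lt_r r_le].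
exists c; split.
- by [].
- have : nu%:R - 1 <= (q * c)%:R :> R.
    by rewrite natrM mulrC -ler_pdivrMr.
  by rewrite nuE ler_nat; lia.
- have : (c%:R - 1) * q%:R < nu%:R - 1 :> R.
    by rewrite -ltr_pdivlMr // -[c%:R - 1](_ : (c%:Z - 1)%:~R = _) // intrB.
  rewrite nuE mulrBl mul1r ltrBlDr -natrM -natrD ltr_nat; lia.
- rewrite div1r natrM -natr1 natrM natrB //; last by lia.
  by congr (_^-1); ring.
Qed.

Lemma inverse_close {R : realType} (D E eps : R) :
  0 < E -> E <= D -> D - E <= eps * E ->
  `|D^-1 - 1 / E| <= eps * `|1 / E|.
Proof.
move=> E_gt0 le_ED close; have D_gt0 := lt_le_trans E_gt0 le_ED.
have [D0 E0] : D != 0 /\ E != 0 by split; exact: lt0r_neq0.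
have -> : D^-1 - 1 / E = - ((D - E) / (D * E)) by field; rewrite D0 E0.
have diff_ge0 : 0 <= (D - E) / (D * E) by rewrite divr_ge0 ?subr_ge0 // ltW ?mulr_gt0.
have invE_ge0 : 0 <= E^-1 by rewrite invr_ge0 ltW.
rewrite normrN div1r (ger0_norm diff_ge0) (ger0_norm invE_ge0).
rewrite ler_pdivrMr ?mulr_gt0 // [leRHS](_ : _ = eps * D); last by field.
have eps_ge0 : 0 <= eps.
  by rewrite -(pmulr_lge0 _ E_gt0) (le_trans _ close) // subr_ge0.
by rewrite (le_trans close) // ler_wpM2l.
Qed.

(** The denominator of the bound exceeds [(q - 1) * nu] by an amount between
    [0] and [q ^ 2], which is negligible before [(q - 1) * nu]. *)
Lemma ratio_bound_asymptotic (R : realType) (q : nat) :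
  (2 <= q)%N ->
  (ratio_bound R q : nat -> R^o) ~_\oo (ratio_bound_equivalent R q : nat -> R^o).
Proof.
move=> hq; apply/eqaddoP => eps eps_gt0.
near=> nu.
have hnu : (2 <= nu)%N by near: nu; exact: nbhs_infty_ge.
have [c [c1 nu_le lt_nu bE]] := @ratio_boundE R q nu hq hnu.
rewrite /= !fctE bE /ratio_bound_equivalent.
have q1_gt0 : 0 < q%:R - 1 :> R by rewrite subr_gt0 ltr1n.
set E : R := (q%:R - 1) * nu%:R; set D : R := (q * (c * (q - 1)).+1)%:R.
have nu_gt0 : 0 < nu%:R :> R by rewrite ltr0n; lia.
have E_gt0 : 0 < E by rewrite mulr_gt0.
pose K : R := (q * q)%:R.
have EE : E = ((q - 1) * nu)%:R by rewrite /E natrM natrB //; lia.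
have le_ED : E <= D by rewrite EE ler_nat; nia.
have le_DK : D - E <= K by rewrite lerBlDr EE -natrD ler_nat; nia.
have KE : K <= eps * E.
  rewrite /E mulrA -ler_pdivrMl ?mulr_gt0 //.
  near: nu; exact: nbhs_infty_ger.
exact: inverse_close E_gt0 le_ED (le_trans le_DK KE).
Unshelve. all: by end_near.
Qed.

Theorem corollary2p3 (R : realType) (q : nat) (hq : (2 <= q)%N) :
  (forall (I : csp_instance R 2 q) (nu : nat),
      strong_chromatic_number I = nu ->
      (2 <= nu)%N ->
      opt I <> wor I ->
      ratio_bound R q nu <= average_differential_ratio I) /\
  (ratio_bound R q : nat -> R^o) ~_\oo
    (ratio_bound_equivalent R q : nat -> R^o).
Proof.
split=> [I nu nuE hnu neq|]; last exact: ratio_bound_asymptotic.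
have colI : strongly_colorable I nu.
  by rewrite -nuE /strong_chromatic_number; case: ex_minnP.
have [c [c1 nu_le _ ->]] := @ratio_boundE R q nu hq hnu.
have [kappa ukappa] := strong_coloring_fun I nu (q * c) colI nu_le.
exact: (average_differential_ratio_ge I kappa).
Qed.
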